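(* Let $A,B\in\mathbb{Z}$ with $A\equiv B\equiv 1\pmod 4$, and let $\mathcal{F}_{2,A,B}(x)=x^{4}+Ax^{3}+Bx^{2}+Ax+1$. Put $W_1=B+2-2A$, $W_2=B+2+2A$, $W_3=A^2-4B+8$. Then $\mathcal{F}_{2,A,B}(x)$ is monogenic if and only if $W_1$, $W_2$ and $W_3$ are all squarefree.
   Context: A monic polynomial $f(x)\in\mathbb{Z}[x]$ is called monogenic if $f(x)$ is irreducible over $\mathbb{Q}$ and $\{1,\theta,\theta^2,\ldots,\theta^{\deg f-1}\}$ is a $\mathbb{Z}$-basis of the ring of integers $\mathbb{Z}_K$ of $K=\mathbb{Q}(\theta)$, where $f(\theta)=0$; equivalently $\mathbb{Z}_K=\mathbb{Z}[\theta]$. *)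

(* Defs.v *)
From HB Require Import structures.
From mathcomp Require Import all_boot all_order all_algebra.
From mathcomp Require Import all_field.

Set Implicit Arguments.
Unset Strict Implicit.
Unset Printing Implicit Defensive.

Import Order.TTheory GRing.Theory Num.Theory.

Local Open Scope ring_scope.

(* In particular 0 is not squarefree and 1, -1 are. *)
Definition squarefreez (n : int) : Prop :=
  forall d : int, (d ^+ 2 %| n)%Z -> d \is a GRing.unit.

Definition is_Zbasis (V : zmodType) (S : V -> Prop) (m : nat)
    (s : m.-tuple V) : Prop :=
  (forall v : V, S v <-> inIntSpan s v) /\
  (forall a : {ffun 'I_m -> int},
     \sum_(i < m) s`_i *~ a i = 0 -> forall i, a i = 0).

Definition ring_of_integers (K : fieldExtType rat) : K -> Prop :=
  integralOver (intr : int -> K).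

Definition power_tuple (K : fieldExtType rat) (theta : K) (m : nat) :
  m.-tuple K := [tuple theta ^+ i | i < m].

(* The number field K = Q(theta) is any extension of rat generated by a root
   theta of f; when f is irreducible such a pair exists (irredp_FAdjoin) and
   is unique up to isomorphism, so the quantification is not vacuous. *)
Definition monogenic (f : {poly int}) : Prop :=
  [/\ f \is monic,
      irreducible_poly (map_poly intr f : {poly rat}) &
      forall (K : fieldExtType rat) (theta : K),
        root (map_poly intr f) theta -> <<1; theta>>%VS = fullv ->
        is_Zbasis (@ring_of_integers K) (power_tuple theta (size f).-1)].

Definition calF2 (A B : int) : {poly int} :=
  'X^4 + A *: 'X^3 + B *: 'X^2 + A *: 'X + 1.

(* Main.v *)
(** Put y = theta + 1/theta. It is a root of x^2 + A x + B - 2, whose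
    discriminant W3 is 1 mod 4, so Z[y] is integrally closed when W3 is
    squarefree. Write an integral element of K as alpha = a + b theta with a, b
    in Q(y), and let alpha' = a + b / theta be its conjugate over Q(y). Then
    e = (alpha - alpha') (theta - 1/theta) = b (y^2 - 4) lies in Z[y] and e^2
    is a multiple of y^2 - 4 in Z[y]. Since Z[y]/(y - 2) = Z/W2 and
    Z[y]/(y + 2) = Z/W1 are reduced when W1 and W2 are squarefree, both y - 2
    and y + 2 divide e, and as W1 is odd this gives b in Z[y]; hence
    a = alpha - b theta is in Z[y] too.

    Conversely, if d^2 divides some Wi, then one of
    (theta + 1)(theta^2 + (A - 2) theta + 1) / d,
    (theta - 1)(theta^2 + (A + 2) theta + 1) / d,
    (2 theta^2 + A theta + 2) / d has its square in Z[theta], so it is integral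
    and must lie in Z[theta], which forces d | 1. *)

Require Import Defs.
From HB Require Import structures.
From mathcomp Require Import all_boot all_order all_algebra.
From mathcomp Require Import all_field.
From mathcomp Require Import ring lra zify.

Set Implicit Arguments.
Unset Strict Implicit.
Unset Printing Implicit Defensive.

Import Order.TTheory GRing.Theory Num.Theory.
Local Open Scope ring_scope.

(** * Squarefree integers and divisibility *)

Lemma squarefreez_neq0 (w : int) : squarefreez w -> w != 0.
Proof.
by move=> sq_w; apply/eqP=> w0; have := sq_w 0; rewrite w0 dvdz0 => /(_ isT).
Qed.

(** With [g] the gcd, [w = w' g] and [m = m' g], the hypothesis gives [w' | g m'^2]. As [w'] is
    coprime to [m'], it divides [g], so [w'^2 | w] and [w'] is a unit. *)
Lemma squarefreez_dvd_sqr (w m : int) :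
  squarefreez w -> (w %| m ^+ 2)%Z -> (w %| m)%Z.
Proof.
move=> sq_w; have w0 := squarefreez_neq0 sq_w.
have [g0 | g0] := eqVneq (gcdz w m) 0.
  by move: w0; rewrite -dvd0z -g0 dvdz_gcdl.
have /dvdzP[w' Ew] := dvdz_gcdl w m; have /dvdzP[m' Em] := dvdz_gcdr w m.
set g := gcdz w m in g0 Ew Em.
have co : coprimez w' m'.
  apply/eqP/(mulIf g0); rewrite mul1r.
  by have := mulz_gcdl w' m' g; rewrite -Ew -Em gez0_abs.
rewrite Em {1}Ew exprMn [g ^+ 2]expr2 mulrA dvdz_mul2r // mulrC.
rewrite Gauss_dvdzl; last by rewrite coprimezXr.
move=> /dvdzP [k Ek].
have /sq_w w'1 : (w' ^+ 2 %| w)%Z by apply/dvdzP; exists k; rewrite Ew Ek; ring.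
by rewrite Ew dvdz_mul2r // -[m'](divrK w'1) dvdz_mull.
Qed.

Lemma squarefreez_rat_int (w : int) (t : rat) :
  squarefreez w -> t ^+ 2 * w%:~R \is a Num.int -> t \is a Num.int.
Proof.
move=> sq_w /intrP[n En].
have E : numq t ^+ 2 * w = n * denq t ^+ 2.
  apply: (@intr_inj rat); rewrite !intrM -En numqE; ring.
have /sq_w d1 : (denq t ^+ 2 %| w)%Z.
  rewrite -(@Gauss_dvdzr _ (numq t ^+ 2)).
    by rewrite E; apply: dvdz_mull (dvdzz _).
  rewrite coprimezXl // coprimezXr // coprimez_sym.
  exact: coprime_num_den.
by rewrite Qint_def; move: d1 (denq_gt0 t); rewrite unfold_in /= => /orP[]/eqP ->.
Qed.

Lemma squarefreez_quotient_int (w e q : int) (x : rat) :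
    squarefreez w -> e ^+ 2 = w * q -> e%:~R = w%:~R * x ->
  x \is a Num.int.
Proof.
move=> sq_w Eq Ex.
have /dvdzP[k Ek] : (w %| e)%Z.
  by apply: squarefreez_dvd_sqr sq_w _; rewrite Eq dvdz_mulr.
have w0 : w%:~R != 0 :> rat by rewrite intr_eq0 squarefreez_neq0.
have -> : x = k%:~R by apply: (mulfI w0); rewrite -Ex Ek intrM mulrC.
exact: intr_int.
Qed.

(** * Integrality over the integers in an extension of the rationals *)

Section IntegralElements.

Variables (K : fieldType) (iota : {rmorphism rat -> K}).

Lemma integral_rat_int (c : rat) :
  integralOver (intr : int -> K) (iota c) -> c \is a Num.int.
Proof.
case=> p mon_p rt.
have Dp : map_poly (intr : int -> K) p = map_poly iota (map_poly intr p).
  by rewrite -map_poly_comp; apply: eq_map_poly => b; rewrite /= rmorph_int.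
have {}rt : root (map_poly (intr : int -> rat) p) c.
  by move: rt; rewrite Dp fmorph_root.
(* The equation is carried over to [algC], where a rational algebraic integer is an integer. *)
have /intrP[n En] : (ratr c : algC) \in Num.int.
  apply: Cint_rat_Aint; first by rewrite Crat_rat.
  apply: (@root_monic_Aint (map_poly intr p)).
  - have -> : map_poly intr p = map_poly ratr (map_poly (intr : int -> rat) p)
      :> {poly algC}.
      by rewrite -map_poly_comp; apply: eq_map_poly => b; rewrite /= rmorph_int.
    by rewrite fmorph_root.
  - by rewrite monic_map.
  - by apply/polyOverP=> i; rewrite coef_map /=.
apply/intrP; exists n; apply: (fmorph_inj (ratr : rat -> algC)).
by rewrite /= En rmorph_int.
Qed.

(** If [p] is a monic equation of [r(y)], then [p \Po r] vanishes at [y], so the irreducible [m]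
    divides it and it vanishes at [y'] as well. *)
Lemma integral_conjugate (m r : {poly rat}) (y y' : K) :
    irreducible_poly m -> root (map_poly iota m) y ->
    root (map_poly iota m) y' ->
  integralOver (intr : int -> K) (map_poly iota r).[y] ->
  integralOver (intr : int -> K) (map_poly iota r).[y'].
Proof.
move=> irr_m my my' [p mon_p rt]; exists p => //.
have Dp : map_poly (intr : int -> K) p = map_poly iota (map_poly intr p).
  by rewrite -map_poly_comp; apply: eq_map_poly => b; rewrite /= rmorph_int.
have E x : (map_poly iota (map_poly intr p)).[(map_poly iota r).[x]] =
    (map_poly iota (map_poly intr p \Po r)).[x].
  by rewrite map_comp_poly horner_comp.
move: rt; rewrite Dp /root !E.
have [/dvdpP[q ->] _ | ] := boolP (m %| map_poly intr p \Po r).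
  by rewrite rmorphM hornerM (eqP my') mulr0.
rewrite -irreducible_poly_coprime // -(coprimep_map iota) => /coprimep_root.
by move=> /(_ _ my) /negP.
Qed.

Lemma irreducible_root_eq0 (m q : {poly rat}) (y : K) :
    irreducible_poly m -> root (map_poly iota m) y ->
    (size q < size m)%N -> root (map_poly iota q) y ->
  q = 0.
Proof.
move=> irr_m my ltqm qy; apply/eqP; apply: contraTT qy => q0.
apply: coprimep_root (my); rewrite coprimep_map.
rewrite irreducible_poly_coprime //; apply: contraL ltqm => /dvdp_leq.
by rewrite -leqNgt; apply.
Qed.

Lemma horner_map_Poly (s : seq rat) (x : K) :
  (map_poly iota (Poly s)).[x] = horner_rec (map iota s) x.
Proof. by rewrite map_Poly horner_Poly. Qed.

Lemma integral_sqr (x : K) :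
  integralOver (intr : int -> K) (x ^+ 2) -> integralOver (intr : int -> K) x.
Proof.
move=> x2; apply: (@integral_root_monic _ _ _ _ ('X^2 - (x ^+ 2)%:P)).
- by rewrite monicXnsubC.
- by rewrite /root !hornerE subrr.
- apply/integral_poly=> i; rewrite coefB coefXn coefC; apply: integral_sub.
    exact: integral_nat.
  by case: ifP => _ //; apply: integral0.
Qed.

End IntegralElements.

(** * Quadratic orders of discriminant 5 modulo 8 *)

Definition quadratic (a b : int) : {poly rat} :=
  Poly [:: b%:~R; a%:~R; 1].

Lemma size_quadratic (a b : int) : size (quadratic a b) = 3%N.
Proof. by rewrite /quadratic (@PolyK _ 0) //= oner_eq0. Qed.

(** For a rational root [x], [2 x + a] would be an integer whose square is the discriminant, but
    squares are 0, 1 or 4 modulo 8. *)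
Lemma irreducible_quadratic (a b : int) :
  (a ^+ 2 - 4 * b = 5 %[mod 8])%Z -> irreducible_poly (quadratic a b).
Proof.
move=> D5; apply: cubic_irreducible => [|x]; first by rewrite size_quadratic.
apply/negP; rewrite /root horner_Poly /= => /eqP Ex.
have /intrP[n En] : 2 * x + a%:~R \is a Num.int.
  apply: (@integral_rat_int _ idfun); apply: integral_sqr.
  have -> : idfun (2 * x + a%:~R) ^+ 2 = (a ^+ 2 - 4 * b)%:~R :> rat.
    rewrite /=; move: Ex; nra.
  exact: integral_id.
have E : n ^+ 2 = a ^+ 2 - 4 * b.
  by apply: (@intr_inj rat); rewrite [LHS]rmorphXn /= -En; nra.
have [q [r [Er r4]]] : exists q r, n = q * 4 + r /\ 0 <= r < 4.
  exists (n %/ 4)%Z, (n %% 4)%Z; split; first exact: divz_eq.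
  by rewrite modz_ge0 ?ltz_pmod.
have En2 : n ^+ 2 = (q ^+ 2 * 2 + q * r) * 8 + r ^+ 2 by rewrite Er; ring.
move: D5; rewrite -E En2 modzMDl.
have : r \in [:: 0; 1; 2; 3] by rewrite !inE; lia.
by rewrite !inE => /or4P[] /eqP ->.
Qed.

Section QuadraticRing.

Variables (K : fieldType) (iota : {rmorphism rat -> K}) (a b : int) (y : K).
Hypothesis D5 : (a ^+ 2 - 4 * b = 5 %[mod 8])%Z.
Hypothesis Ey : y ^+ 2 + a%:~R * y + b%:~R = 0.

Lemma root_quadratic : root (map_poly iota (quadratic a b)) y.
Proof.
rewrite /root horner_map_Poly /= rmorph1 !rmorph_int.
by apply/eqP; rewrite -[RHS]Ey; ring.
Qed.

(** The trace and the norm of [s + t y] are integers, and [t^2] times the discriminant is the trace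
    squared minus four times the norm. This makes [t] an integer, and a parity argument then handles
    [s]. *)
Lemma quadratic_integral (s t : rat) :
    squarefreez (a ^+ 2 - 4 * b) ->
    integralOver (intr : int -> K) (iota s + iota t * y) ->
  s \is a Num.int /\ t \is a Num.int.
Proof.
move=> sqD int1.
(* [- a - y] is the other root of the quadratic. *)
have int2 : integralOver (intr : int -> K) (iota s + iota t * (- a%:~R - y)).
  have E x : (map_poly iota (Poly [:: s; t])).[x] = iota s + iota t * x.
    by rewrite horner_map_Poly /=; ring.
  rewrite -E; apply: (integral_conjugate (irreducible_quadratic D5)
    root_quadratic); last by rewrite E.
  rewrite /root horner_map_Poly /= rmorph1 !rmorph_int.
  by apply/eqP; rewrite -[RHS]Ey; ring.
have Zm : 2 * s - t * a%:~R \is a Num.int.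
  apply: (integral_rat_int (iota := iota)); have := integral_add int1 int2.
  congr integralOver; ring.
have Zn : s ^+ 2 - s * t * a%:~R + t ^+ 2 * b%:~R \is a Num.int.
  apply: (integral_rat_int (iota := iota)); have := integral_mul int1 int2.
  congr integralOver.
  have Eb : iota b%:~R = - (y ^+ 2 + a%:~R * y).
    by rewrite rmorph_int; apply/eqP; rewrite -addr_eq0 addrC Ey.
  rewrite rmorphD [iota (t ^+ 2 * _)]rmorphM /= Eb; ring.
have Zt : t \is a Num.int.
  apply: squarefreez_rat_int sqD _.
  have -> : t ^+ 2 * (a ^+ 2 - 4 * b)%:~R =
     (2 * s - t * a%:~R) ^+ 2 - 4 * (s ^+ 2 - s * t * a%:~R + t ^+ 2 * b%:~R).
    by ring.
  by rewrite rpredB ?rpredM ?rpredX.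
split=> //; move: Zt Zm Zn => /intrP[n ->] /intrP[m Em] /intrP[k Ek].
have Es : s = (m + n * a)%:~R / 2 by rewrite rmorphD rmorphM /=; lra.
have E : (m + n * a) ^+ 2 - 2 * (m + n * a) * n * a + 4 * n ^+ 2 * b = 4 * k.
  by apply: (@intr_inj rat); rewrite [RHS]rmorphM /= -Ek Es; field.
have [l El] : exists l, m + n * a = 2 * l.
  exists ((m + n * a) %/ 2)%Z; set w := m + n * a in E *.
  have : (w ^+ 2 = 2 * (2 * k - 2 * n ^+ 2 * b + w * n * a)).
    by move: E; set w2 := w ^+ 2; lia.
  have := divz_eq w 2; have := modz_ge0 w (isT : 2 != 0 :> int).
  have := ltz_pmod w (isT : 0 < 2 :> int).
  move: (w %/ 2)%Z (w %% 2)%Z => q r; nia.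
by apply/intrP; exists l; rewrite Es El rmorphM /=; field.
Qed.

End QuadraticRing.

(** * Irreducibility of the quartic *)

Lemma calF2E (A B : int) : calF2 A B = Poly [:: 1; A; B; A; 1].
Proof.
apply/polyP=> i; rewrite /calF2 coef_Poly !coefD !coefZ !coefXn coefX coef1.
by case: i => [|[|[|[|[|i]]]]] /=;
   rewrite ?nth_nil ?mulr0 ?mulr1 ?addr0 ?add0r.
Qed.

Lemma size_calF2 (A B : int) : size (calF2 A B) = 5%N.
Proof. by rewrite calF2E (@PolyK _ 0). Qed.

Lemma calF2_monic (A B : int) : calF2 A B \is monic.
Proof. by rewrite monicE lead_coefE size_calF2 calF2E coef_Poly. Qed.

(* The reduction x^4+x^3+x^2+x+1 modulo 2 has no factorisation into factors of
   degrees at most 2 and 3. *)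
Lemma calF2_neq_mul (A B : int) (p r : {poly int}) :
    (A = 1 %[mod 2])%Z -> (B = 1 %[mod 2])%Z ->
    (size p <= 3)%N -> (size r <= 4)%N -> calF2 A B <> p * r.
Proof.
move=> oddA oddB p3 r4 Epr.
have red n : (n = 1 %[mod 2])%Z -> (n%:~R : 'F_2) = 1.
  move=> n1; rewrite (divz_eq n 2) n1 rmorphD rmorphM /=.
  by rewrite [2%:~R](_ : _ = 0) ?mulr0 //; apply/eqP.
have p0 k : p`_k.+3 = 0 by apply: nth_default; apply: leq_trans p3 _.
have r0 k : r`_k.+4 = 0 by apply: nth_default; apply: leq_trans r4 _.
have E k : ((calF2 A B)`_k)%:~R =
    \sum_(i < k.+1) (p`_i)%:~R * (r`_(k - i))%:~R :> 'F_2.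
  by rewrite Epr coefM rmorph_sum; apply: eq_bigr => i _; rewrite rmorphM.
(* Coefficients 0 to 5 are all that a product of these sizes can have. The seven unknown
   coefficients in ['F_2] are then enumerated. *)
have := E 5%N; have := E 4%N; have := E 3%N.
have := E 2%N; have := E 1%N; have := E 0%N.
rewrite !big_ord_recl !big_ord0 calF2E !coef_Poly /= /bump /=.
rewrite !subn0 !subSS !subn0.
rewrite ?addn0 ?add1n !p0 !r0 (red A) // (red B) // {E p0 r0 Epr p3 r4}.
move: ((p`_0)%:~R : 'F_2) ((p`_1)%:~R : 'F_2) ((p`_2)%:~R : 'F_2)
  ((r`_0)%:~R : 'F_2)
  ((r`_1)%:~R : 'F_2) ((r`_2)%:~R : 'F_2) ((r`_3)%:~R : 'F_2).
have F2 (x : 'F_2) : x = 0 \/ x = 1.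
  by case: x => [[|[|//]]] i; [left | right]; apply: val_inj.
move=> x0 x1 x2 y0 y1 y2 y3.
case: (F2 x0) => ->; case: (F2 x1) => ->; case: (F2 x2) => ->;
case: (F2 y0) => ->; case: (F2 y1) => ->; case: (F2 y2) => ->;
by case: (F2 y3) => ->.
Qed.

(** By Gauss's lemma a rational factorisation may be taken over the integers. The two degrees add up
    to 4 and neither is 0, so one is at most 2 and the other at most 3. *)
Lemma calF2_irreducible (A B : int) :
    (A = 1 %[mod 2])%Z -> (B = 1 %[mod 2])%Z ->
  irreducible_poly (map_poly (intr : int -> rat) (calF2 A B)).
Proof.
move=> oddA oddB; split; first by rewrite size_rat_int_poly size_calF2.
move=> f' + /dvdpP_rat_int[p [d d0 Ef] [r Epr]].
rewrite {f'}Ef size_scale // size_rat_int_poly => p1.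
rewrite (eqp_trans (eqp_scale _ d0)) // Epr.
have pr0 : p * r != 0 by rewrite -Epr -size_poly_eq0 size_calF2.
have [p0 r0] : p != 0 /\ r != 0 by apply/andP; rewrite -negb_or -mulf_eq0.
have [/eqP/size_poly1P[c c0 ->]|r1] := eqVneq (size r) 1%N.
  by rewrite mulrC mul_polyC map_polyZ /= eqp_sym eqp_scale // intr_eq0.
have pg0 : (0 < size p)%N by rewrite size_poly_gt0.
have rg0 : (0 < size r)%N by rewrite size_poly_gt0.
have := size_calF2 A B; rewrite Epr size_mul // => sz.
have le4 m n : (m != 1 -> 0 < m -> (m + n).-1 = 5 -> n <= 4)%N by lia.
have le3 m n : (3 < m -> (m + n).-1 = 5 -> n <= 3)%N by lia.
have [p3 | p3] := leqP (size p) 3.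
  by case: (calF2_neq_mul oddA oddB p3 (le4 _ _ p1 pg0 sz) Epr).
have r3 := le3 _ _ p3 sz; rewrite addnC in sz.
by case: (calF2_neq_mul oddA oddB r3 (le4 _ _ r1 rg0 sz)); rewrite mulrC.
Qed.

(** * Integral elements have integer coordinates when the three values are squarefree *)

Section QuarticRing.

Variables (K : fieldType) (iota : {rmorphism rat -> K}) (A B : int) (th : K).
Hypotheses (hA : (A = 1 %[mod 4])%Z) (hB : (B = 1 %[mod 4])%Z).
Hypothesis Eth : th ^+ 4 + A%:~R * th ^+ 3 + B%:~R * th ^+ 2 + A%:~R * th + 1 = 0.

Local Notation fQ := (map_poly (intr : int -> rat) (calF2 A B)).

Lemma irreducible_calF2Q : irreducible_poly fQ.
Proof. by apply: calF2_irreducible; move: hA hB; lia. Qed.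

Lemma root_calF2P (x : K) :
  reflect (x ^+ 4 + A%:~R * x ^+ 3 + B%:~R * x ^+ 2 + A%:~R * x + 1 = 0)
    (root (map_poly iota fQ) x).
Proof.
rewrite /root calF2E map_Poly horner_map_Poly /= !rmorph_int rmorph1.
by apply: (iffP eqP) => E; rewrite -[RHS]E; ring.
Qed.

Lemma theta_neq0 : th != 0.
Proof.
apply/eqP=> th0; have := Eth; rewrite th0 !expr0n /= !mulr0 !add0r.
by apply/eqP; rewrite oner_eq0.
Qed.

Let y := th + th^-1.

Lemma trace_quadratic : y ^+ 2 + A%:~R * y + (B - 2)%:~R = 0.
Proof.
apply: (mulfI (expf_neq0 2 theta_neq0)); rewrite mulr0 -[RHS]Eth /y.
by field; apply: theta_neq0.
Qed.

(** The quartic is palindromic. *)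
Lemma root_theta_inv : root (map_poly iota fQ) th^-1.
Proof.
apply/root_calF2P; apply: (mulfI (expf_neq0 4 theta_neq0)).
by rewrite mulr0 -[RHS]Eth; field; apply: theta_neq0.
Qed.

Lemma integral_root_calF2 (x : K) :
  root (map_poly iota fQ) x -> integralOver (intr : int -> K) x.
Proof.
move=> rx; exists (calF2 A B); first exact: calF2_monic.
congr (is_true (root _ x)): rx; rewrite -map_poly_comp.
by apply: eq_map_poly => n; rewrite /= rmorph_int.
Qed.

Lemma calF2_integral_coef (c0 c1 c2 c3 : rat) :
    squarefreez (B + 2 - 2 * A) -> squarefreez (B + 2 + 2 * A) ->
    squarefreez (A ^+ 2 - 4 * B + 8) ->
    integralOver (intr : int -> K)
      (iota c0 + iota c1 * th + iota c2 * th ^+ 2 + iota c3 * th ^+ 3) ->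
  [/\ c0 \is a Num.int, c1 \is a Num.int, c2 \is a Num.int & c3 \is a Num.int].
Proof.
move=> sq1 sq2 sq3; set al := (X in integralOver _ X) => int_al.
have th0 := theta_neq0; have Ey := trace_quadratic.
have D3 : A ^+ 2 - 4 * B + 8 = A ^+ 2 - 4 * (B - 2) by ring.
have D5 : (A ^+ 2 - 4 * (B - 2) = 5 %[mod 8])%Z.
  have -> : A = (A %/ 4)%Z * 4 + 1 by rewrite {1}(divz_eq A 4) hA.
  have -> : B = (B %/ 4)%Z * 4 + 1 by rewrite {1}(divz_eq B 4) hB.
  set q := (A %/ 4)%Z; set r := (B %/ 4)%Z.
  have -> : (q * 4 + 1) ^+ 2 - 4 * (r * 4 + 1 - 2) =
     (2 * q ^+ 2 + q - 2 * r) * 8 + 5 by ring.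
  by rewrite modzMDl.
rewrite D3 in sq3.
have int_y := quadratic_integral D5 Ey sq3.
pose al' := iota c0 + iota c1 * th^-1 + iota c2 * th^-1 ^+ 2
  + iota c3 * th^-1 ^+ 3.
have rt : root (map_poly iota fQ) th by apply/root_calF2P.
have int_al' : integralOver (intr : int -> K) al'.
  have E x : (map_poly iota (Poly [:: c0; c1; c2; c3])).[x] =
      iota c0 + iota c1 * x + iota c2 * x ^+ 2 + iota c3 * x ^+ 3.
    by rewrite horner_map_Poly /=; ring.
  rewrite /al' -E; apply: (integral_conjugate irreducible_calF2Q rt).
    exact: root_theta_inv.
  by rewrite E.
have int_th := integral_root_calF2 rt.
have int_thV := integral_root_calF2 root_theta_inv.
(* Coordinates of [al = (a0 + a1 y) + (b0 + b1 y) th], found from [th^2 = y th - 1],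
   [th^3 = (y^2 - 1) th - y] and the quadratic equation of [y]. *)
pose a0 := c0 - c2; pose a1 := - c3.
pose b0 := c1 - c3 * (B - 1)%:~R; pose b1 := c2 - A%:~R * c3.
pose b := iota b0 + iota b1 * y.
have Ey2 : y ^+ 2 = - (A%:~R * y + (B - 2)%:~R).
  by apply/eqP; rewrite -addr_eq0 addrA Ey.
have Eth3 : th ^+ 3 = (y ^+ 2 - 1) * th - y by rewrite /y; field.
have Ealpha : al = iota a0 + iota a1 * y + b * th.
  rewrite /al /b /a0 /a1 /b0 /b1 Eth3.
  have -> : th ^+ 2 = y * th - 1 by rewrite /y; field.
  rewrite Ey2; ring.
have Ediff : al - al' = b * (th - th^-1).
  rewrite /al /al' /b /b0 /b1.
  have -> : (B - 1)%:~R = (B - 2)%:~R + 1 :> rat by ring.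
  have EB : iota (B - 2)%:~R = - (y ^+ 2 + A%:~R * y).
    by rewrite rmorph_int Ey2; ring.
  rewrite rmorphB [iota (c3 * _)]rmorphM rmorphD /= EB /y; field.
  exact: th0.
(* Coordinates of [(u + v y) (y ^+ 2 - 4)] in the basis [1, y]. *)
pose mulE (u v : rat) : rat * rat :=
  (A%:~R * (B - 2)%:~R * v - (B + 2)%:~R * u,
   (A ^+ 2 - B - 2)%:~R * v - A%:~R * u).
have mulP u v :
    (iota u + iota v * y) * (th - th^-1) ^+ 2 =
    iota (mulE u v).1 + iota (mulE u v).2 * y.
  have -> : (th - th^-1) ^+ 2 = y ^+ 2 - 4 by rewrite /y; field.
  rewrite /mulE /=; transitivity ((iota u - iota v * A%:~R) * (y ^+ 2)
    + iota v * (- (B - 2)%:~R) * y - 4 * (iota u + iota v * y)).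
    have -> : - (B - 2)%:~R = y ^+ 2 + A%:~R * y by rewrite Ey2; ring.
    ring.
  rewrite Ey2; ring.
have int_d : integralOver (intr : int -> K) (al - al') by apply: integral_sub.
have [Ze0 Ze1] : (mulE b0 b1).1 \is a Num.int /\ (mulE b0 b1).2 \is a Num.int.
  apply: (int_y iota); rewrite -mulP -/b expr2 mulrA -Ediff.
  by apply: integral_mul; last apply: integral_sub.
(* [p0] and [p1] are the coordinates of [b^2], so [mulE p0 p1] gives those of [(al - al')^2]. *)
pose p0 := b0 ^+ 2 - (B - 2)%:~R * b1 ^+ 2.
pose p1 := 2 * b0 * b1 - A%:~R * b1 ^+ 2.
have [Zz0 Zz1] : (mulE p0 p1).1 \is a Num.int /\ (mulE p0 p1).2 \is a Num.int.
  apply: (int_y iota); rewrite -mulP.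
  have -> : iota p0 + iota p1 * y = b ^+ 2.
    rewrite /b /p0 /p1; transitivity (iota b0 ^+ 2
      + 2 * iota b0 * iota b1 * y + iota b1 ^+ 2 * (y ^+ 2)); last by ring.
    rewrite Ey2; ring.
  by rewrite -exprMn -Ediff expr2; apply: integral_mul.
move: Ze0 Ze1 => /intrP[e0 Ee0] /intrP[e1 Ee1].
move: Zz0 Zz1 => /intrP[z0 Ez0] /intrP[z1 Ez1].
(* [e0 + 2 e1] and [e0 - 2 e1] are the images of [e0 + e1 y] modulo [y - 2]
   and [y + 2], where [e ^+ 2 = (y ^+ 2 - 4) * (z0 + z1 y)] vanishes. *)
have Zn2 : (A - 2)%:~R * b1 - b0 \is a Num.int.
  apply: (@squarefreez_quotient_int _ (e0 + 2 * e1)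
    (e1 ^+ 2 - z0 + (A - 2) * z1) _ sq2).
    (* Dividing [(e0 + e1 Y)^2 - (Y^2 - 4) (z0 + z1 Y)] by [Y^2 + A Y + B - 2] leaves the quotient
       [e1^2 - z0 + A z1 - z1 Y]. The cofactor is its value at [Y = 2], where the divisor is
       [B + 2 + 2 A]; [Y = -2] serves for [Zn1]. *)
    apply: (@intr_inj rat).
    transitivity ((e0%:~R + 2 * e1%:~R) ^+ 2 : rat); first by ring.
    transitivity ((B + 2 + 2 * A)%:~R *
      (e1%:~R ^+ 2 - z0%:~R + (A - 2)%:~R * z1%:~R) : rat); last by ring.
    rewrite -Ee0 -Ee1 -Ez0 -Ez1 /mulE /p0 /p1 /=; ring.
  transitivity (e0%:~R + 2 * e1%:~R : rat); first by ring.
  rewrite -Ee0 -Ee1 /mulE /=; ring.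
have Zn1 : (A + 2)%:~R * b1 - b0 \is a Num.int.
  apply: (@squarefreez_quotient_int _ (e0 - 2 * e1)
    (e1 ^+ 2 - z0 + (A + 2) * z1) _ sq1).
    apply: (@intr_inj rat).
    transitivity ((e0%:~R - 2 * e1%:~R) ^+ 2 : rat); first by ring.
    transitivity ((B + 2 - 2 * A)%:~R *
      (e1%:~R ^+ 2 - z0%:~R + (A + 2)%:~R * z1%:~R) : rat); last by ring.
    rewrite -Ee0 -Ee1 -Ez0 -Ez1 /mulE /p0 /p1 /=; ring.
  transitivity (e0%:~R - 2 * e1%:~R : rat); first by ring.
  rewrite -Ee0 -Ee1 /mulE /=; ring.
have Z4 : 4 * b1 \is a Num.int.
  have -> : 4 * b1 =
      (A + 2)%:~R * b1 - b0 - ((A - 2)%:~R * b1 - b0) by ring.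
  exact: rpredB.
have Zw1 : (B + 2 - 2 * A)%:~R * b1 \is a Num.int.
  have -> : (B + 2 - 2 * A)%:~R * b1 =
      A%:~R * ((A - 2)%:~R * b1 - b0) - e1%:~R.
    by rewrite -Ee1 /mulE /=; ring.
  by rewrite rpredB ?rpredM ?intr_int.
have Zb1 : b1 \is a Num.int.
  (* [B + 2 - 2 A] is 1 modulo 4, so [b1] is an integral combination of [4 b1] and
     [(B + 2 - 2 A) b1]. *)
  have [q Eq] : exists q : int, B + 2 - 2 * A = q * 4 + 1.
    by exists ((B + 2 - 2 * A) %/ 4)%Z; move: hA hB; lia.
  have -> : b1 = (B + 2 - 2 * A)%:~R * b1 - q%:~R * (4 * b1).
    by rewrite Eq; ring.
  by apply: rpredB => //; apply: rpredM => //; apply: intr_int.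
have Zb0 : b0 \is a Num.int.
  have -> : b0 = (A - 2)%:~R * b1 - ((A - 2)%:~R * b1 - b0) by ring.
  by rewrite rpredB ?rpredM ?intr_int.
have int_iota (c : rat) :
    c \is a Num.int -> integralOver (intr : int -> K) (iota c).
  by move=> /intrP[n ->]; rewrite rmorph_int; apply: integral_id.
have [Za0 Za1] : a0 \is a Num.int /\ a1 \is a Num.int.
  apply: (int_y iota).
  have -> : iota a0 + iota a1 * y = al - b * th by rewrite Ealpha; ring.
  apply: integral_sub => //; apply: integral_mul => //.
  by do ?[apply: integral_add | apply: integral_mul | apply: int_iota | by []].
have Zc3 : c3 \is a Num.int by rewrite -[c3]opprK rpredN.
have Zc2 : c2 \is a Num.int.
  have -> : c2 = b1 + A%:~R * c3 by rewrite /b1; ring.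
  by rewrite rpredD ?rpredM ?intr_int.
split=> //.
  have -> : c0 = a0 + c2 by rewrite /a0; ring.
  by rewrite rpredD.
have -> : c1 = b0 + c3 * (B - 1)%:~R by rewrite /b0; ring.
by rewrite rpredD ?rpredM ?intr_int.
Qed.
End QuarticRing.

(** * The power basis, with coordinate vectors read as polynomials of size at most 4 *)

Section PowerBasis.

Variables (K : fieldExtType rat) (theta : K) (A B : int).
Hypotheses (hA : (A = 1 %[mod 4])%Z) (hB : (B = 1 %[mod 4])%Z).
Hypothesis root_theta : root (map_poly intr (calF2 A B)) theta.

Local Notation fQ := (map_poly (intr : int -> rat) (calF2 A B)).
Local Notation eval r := (map_poly (in_alg K) r).[theta].

Lemma calF2_theta_eq0 : theta ^+ 4 + A%:~R * theta ^+ 3 + B%:~R * theta ^+ 2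
  + A%:~R * theta + 1 = 0.
Proof.
move: root_theta; rewrite /root calF2E map_Poly horner_Poly /= => /eqP E.
by rewrite -[RHS]E; ring.
Qed.

Lemma root_calF2Q : root (map_poly (in_alg K) fQ) theta.
Proof. by apply/root_calF2P; apply: calF2_theta_eq0. Qed.

Lemma size_calF2Q : size fQ = 5%N.
Proof. by rewrite size_rat_int_poly size_calF2. Qed.

Lemma eval_coef (r : {poly rat}) : (size r <= 4)%N ->
  eval r = \sum_(i < 4) r`_i *: theta ^+ i.
Proof.
move=> r4; rewrite (@horner_coef_wide _ 4); last by rewrite size_map_poly.
by apply: eq_bigr => i _; rewrite coef_map /= mulr_algl.
Qed.

Lemma eval_inj (r r' : {poly rat}) : (size r <= 4)%N -> (size r' <= 4)%N ->
  eval r = eval r' -> r = r'.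
Proof.
move=> r4 r'4 E; apply/eqP; rewrite -subr_eq0; apply/eqP.
apply: (irreducible_root_eq0 (irreducible_calF2Q hA hB) root_calF2Q).
  rewrite size_calF2Q ltnS; apply: leq_trans (size_polyD _ _) _.
  by rewrite size_polyN geq_max r4.
by rewrite /root rmorphB hornerD hornerN E subrr.
Qed.

Lemma eval_surj (v : K) : <<1; theta>>%VS = fullv ->
  exists2 r : {poly rat}, (size r <= 4)%N & v = eval r.
Proof.
move=> gen; have: v \in <<1; theta>>%VS by rewrite gen memvf.
case/Fadjoin_polyP=> p /polyOver1P[q ->] ->; exists (q %% fQ).
  by rewrite -ltnS -size_calF2Q ltn_modp -size_poly_eq0 size_calF2Q.
rewrite {1}(divp_eq q fQ) rmorphD rmorphM hornerD hornerM.
by rewrite (eqP root_calF2Q) mulr0 add0r.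
Qed.

Lemma power_tupleE (a : {ffun 'I_4 -> int}) :
  \sum_(i < 4) (power_tuple theta 4)`_i *~ a i =
  eval (\poly_(i < 4) (a (inord i))%:~R).
Proof.
rewrite eval_coef ?size_poly //; apply: eq_bigr => i _.
by rewrite coef_poly ltn_ord inord_val nth_mktuple scaler_int.
Qed.

Lemma Zbasis_coef_int (r : {poly rat}) (i : nat) :
    is_Zbasis (@ring_of_integers K) (power_tuple theta 4) ->
    (size r <= 4)%N -> integralOver (intr : int -> K) (eval r) ->
  r`_i \is a Num.int.
Proof.
move=> [span _] r4 /span[a]; rewrite power_tupleE => /eval_inj -> //.
  by rewrite coef_poly; case: ifP; rewrite ?intr_int ?rpred0.
Qed.

Lemma calF2_Zbasis :
    squarefreez (B + 2 - 2 * A) -> squarefreez (B + 2 + 2 * A) ->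
    squarefreez (A ^+ 2 - 4 * B + 8) -> <<1; theta>>%VS = fullv ->
  is_Zbasis (@ring_of_integers K) (power_tuple theta 4).
Proof.
move=> sq1 sq2 sq3 gen; split=> [v | a].
  split=> [int_v | [a ->]]; last first.
    rewrite /ring_of_integers power_tupleE; apply: integral_horner; last first.
      exact: integral_root_calF2 root_calF2Q.
    apply/integral_poly=> i; rewrite coef_map coef_poly /=; case: ifP => _.
      by rewrite scaler_int; apply: integral_id.
    by rewrite scale0r; apply: integral0.
  have [r r4 Ev] := eval_surj v gen.
  have Zr (i : nat) : (i < 4)%N -> r`_i \is a Num.int.
    have [] := @calF2_integral_coef _ (in_alg K) _ _ _ hA hB calF2_theta_eq0
      r`_0 r`_1 r`_2 r`_3 sq1 sq2 sq3.
      have := int_v; rewrite /ring_of_integers Ev eval_coef //.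
      congr integralOver; rewrite !big_ord_recl big_ord0 /= /bump /= !add1n.
      by rewrite !mulr_algl expr0 expr1 addr0 !addrA.
    by move=> Z0 Z1 Z2 Z3; case: i => [|[|[|[|]]]].
  exists [ffun i : 'I_4 => numq r`_i]; rewrite power_tupleE Ev.
  congr (eval _); apply/polyP=> i; rewrite coef_poly; case: ltnP => [i4 | i4].
    rewrite ffunE inordK //; have /intrP[n ->] := Zr i i4.
    by rewrite numq_int.
  by rewrite nth_default // (leq_trans r4).
rewrite power_tupleE => E i.
have /(congr1 (fun r : {poly rat} => r`_i)) :
    \poly_(j < 4) (a (inord j))%:~R = 0 :> {poly rat}.
  by apply: eval_inj; rewrite ?size_poly ?size_poly0 // rmorph0 horner0.
by rewrite coef0 coef_poly ltn_ord inord_val => /eqP; rewrite intr_eq0 => /eqP.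
Qed.

(** The square of [c(theta) / d] is [w / d^2] times [q(theta)], so [c(theta) / d] is integral and
    its coordinates [c_i / d] are integers. The condition [w != 0] excludes [d = 0]. *)
Lemma Zbasis_dvd (w d : int) (c q : {poly int}) (i : nat) :
    is_Zbasis (@ring_of_integers K) (power_tuple theta 4) ->
    (size c <= 4)%N -> w != 0 -> (d ^+ 2 %| w)%Z ->
    (map_poly intr c).[theta] ^+ 2 = w%:~R * (map_poly intr q).[theta] ->
  (d %| c`_i)%Z.
Proof.
move=> basis c4 w0 /dvdzP[k Ew] Ec.
have d0 : d != 0 by apply: contra_neq w0 => d0; rewrite Ew d0 expr0n mulr0.
have dK : d%:~R != 0 :> K.
  by rewrite -(rmorph_int (in_alg K)) fmorph_eq0 intr_eq0.
pose r := d%:~R^-1 *: map_poly (intr : int -> rat) c.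
have Er : d%:~R * eval r = (map_poly intr c).[theta].
  rewrite /r map_polyZ hornerZ fmorphV rmorph_int mulVKf //.
  rewrite -map_poly_comp; congr (_.[_]).
  by apply: eq_map_poly => n; rewrite /= scaler_int.
have r4 : (size r <= 4)%N.
  by apply: leq_trans (size_scale_leq _ _) _; rewrite size_rat_int_poly.
have int_r : integralOver (intr : int -> K) (eval r).
  apply: integral_sqr.
  have -> : eval r ^+ 2 = k%:~R * (map_poly intr q).[theta].
    apply: (mulfI (expf_neq0 2 dK)); rewrite -exprMn Er Ec Ew; ring.
  apply: integral_mul; first exact: integral_id.
  apply: integral_horner; last exact: integral_root_calF2 root_calF2Q.
  by apply/integral_poly=> j; rewrite coef_map; apply: integral_id.
have /intrP[n] := Zbasis_coef_int i basis r4 int_r.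
rewrite coefZ coef_map /= => En; apply/dvdzP; exists n.
apply: (@intr_inj rat); rewrite intrM -En mulrAC mulVf ?mul1r //.
by rewrite intr_eq0.
Qed.

(* Each of the identities f = (x+1)^2 (x^2+(A-2)x+1) + W1 x^2,
   f = (x-1)^2 (x^2+(A+2)x+1) + W2 x^2, 4f = (2x^2+Ax+2)^2 - W3 x^2 makes the
   square of an element of Z[theta] divisible by some Wi. *)
Lemma Zbasis_squarefree :
    is_Zbasis (@ring_of_integers K) (power_tuple theta 4) ->
  [/\ squarefreez (B + 2 - 2 * A), squarefreez (B + 2 + 2 * A) &
      squarefreez (A ^+ 2 - 4 * B + 8)].
Proof.
move=> basis.
pose F := theta ^+ 4 + A%:~R * theta ^+ 3 + B%:~R * theta ^+ 2
  + A%:~R * theta + 1.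
have Eth : F = 0 by apply: calF2_theta_eq0.
have [a Ea] : exists a, A = 2 * a + 1 by exists (A %/ 2)%Z; move: hA; lia.
have evalZ (s : seq int) :
    (map_poly intr (Poly s)).[theta] = horner_rec (map intr s) theta.
  by rewrite map_Poly horner_Poly.
have unit_dvd1 (d : int) : (d %| 1%R)%Z -> d \is a GRing.unit.
  by move=> /dvdzP[n En]; apply/unitrPr; exists n; rewrite mulrC.
split=> d dvd_d; apply: unit_dvd1.
(* With [g = x^2 + (A - 2) x + 1], [c = (x + 1) g] and [q = - x^2 g], so that [c^2 - W1 q = g f]. *)
- pose c : {poly int} := Poly [:: 1; A - 1; A - 1; 1].
  pose q : {poly int} := Poly [:: 0; 0; -1; - (A - 2); -1].
  have -> : 1 = c`_0 by rewrite coef_Poly.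
  apply: (Zbasis_dvd (q := q) _ basis _ _ dvd_d _).
  - exact: leq_trans (size_Poly _) _.
  - by apply/eqP; lia.
  rewrite !evalZ /=; apply/eqP; rewrite -subr_eq0; apply/eqP.
  by transitivity ((theta ^+ 2 + (A - 2)%:~R * theta + 1) * F);
    [rewrite /F; ring | rewrite Eth mulr0].
(* Likewise [c = (x - 1) g] and [q = - x^2 g] with [g = x^2 + (A + 2) x + 1]. *)
- pose c : {poly int} := Poly [:: -1; - (A + 1); A + 1; 1].
  pose q : {poly int} := Poly [:: 0; 0; -1; - (A + 2); -1].
  have -> : 1 = c`_3 by rewrite coef_Poly.
  apply: (Zbasis_dvd (q := q) _ basis _ _ dvd_d _).
  - exact: leq_trans (size_Poly _) _.
  - by apply/eqP; lia.
  rewrite !evalZ /=; apply/eqP; rewrite -subr_eq0; apply/eqP.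
  by transitivity ((theta ^+ 2 + (A + 2)%:~R * theta + 1) * F);
    [rewrite /F; ring | rewrite Eth mulr0].
pose c : {poly int} := Poly [:: 2; A; 2].
pose q : {poly int} := Poly [:: 0; 0; 1].
have dvd_c i : (d %| c`_i)%Z.
  apply: (Zbasis_dvd (q := q) _ basis _ _ dvd_d _).
  - exact: leq_trans (size_Poly _) _.
  - by apply/eqP; rewrite Ea; lia.
  rewrite !evalZ /=; apply/eqP; rewrite -subr_eq0; apply/eqP.
  by transitivity (4 * F); [rewrite /F; ring | rewrite Eth mulr0].
(* [d] divides the coefficients 2 and [A = 2 a + 1], hence also [A - 2 a = 1]. *)
have /dvdzP[k Ek] := dvd_c 0%N; have /dvdzP[l El] := dvd_c 1%N.
move: Ek El; rewrite !coef_Poly /= Ea => Ek El.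
by apply/dvdzP; exists (l - a * k); rewrite mulrBl -El -mulrA -Ek; ring.
Qed.

End PowerBasis.

Theorem theorem1p2 (A B : int)
    (hA : (A = 1 %[mod 4])%Z) (hB : (B = 1 %[mod 4])%Z) :
  monogenic (calF2 A B) <->
  [/\ squarefreez (B + 2 - 2 * A),
      squarefreez (B + 2 + 2 * A) &
      squarefreez (A ^+ 2 - 4 * B + 8)].
Proof.
have irr := irreducible_calF2Q hA hB.
split=> [[_ _ basis] | [sq1 sq2 sq3]].
  have [K _ [theta root_theta gen]] := irredp_FAdjoin irr.
  have root_th : root (map_poly intr (calF2 A B)) theta.
    move: root_theta; rewrite -map_poly_comp; congr (is_true (root _ _)).
    by apply: eq_map_poly => n; rewrite /= scaler_int.
  apply: (Zbasis_squarefree hA hB root_th).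
  by have := basis K theta root_th gen; rewrite size_calF2.
split=> [||K theta root_th gen]; [exact: calF2_monic | exact: irr | ].
rewrite size_calF2; exact: (calF2_Zbasis hA hB root_th sq1 sq2 sq3 gen).
Qed.
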